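(* For every graph $G$, $$\mathit{eq}(L(G)) \le \sigma(G) \le 3\,\mathit{eq}(L(G)).$$
   Context: An equivalence graph is a disjoint union of cliques. The equivalence number $\mathit{eq}(H)$ of a graph $H$ is the minimum number of subgraphs of $H$, each an equivalence graph, whose union covers all edges of $H$. $L(G)$ is the line graph of $G$ (vertices are the edges of $G$, adjacent iff they share an endpoint). An orientation covering of $G$ is a set of orientations $\overrightarrow{G_1},\dots,\overrightarrow{G_k}$ of $G$ such that for every vertex $u$ and any two distinct neighbors $v,w$ of $u$, some $\overrightarrow{G_i}$ contains both arcs $\overrightarrow{uv}$ and $\overrightarrow{uw}$. $\sigma(G)$ is the minimum size of an orientation covering of $G$. *)

(* Defs.v *)
From mathcomp Require Import all_boot.

Set Implicit Arguments.
Unset Strict Implicit.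
Unset Printing Implicit Defensive.

Record sgraph := SGraph {
  vert :> finType;
  adj : rel vert;
  adj_sym : symmetric adj;
  adj_irrefl : irreflexive adj
}.

Definition edges (G : sgraph) : {set {set G}} :=
  [set [set p.1; p.2] | p : G * G & adj p.1 p.2].

(* A (not necessarily spanning or induced) subgraph is encoded by the pair of *)
(* its vertex set and its edge set.                                           *)
Definition subgraph_of (H : sgraph) (K : {set H} * {set {set H}}) : bool :=
  (K.2 \subset edges H) && [forall A in K.2, A \subset K.1].

Definition clique_edges (T : finType) (B : {set T}) : {set {set T}} :=
  [set A : {set T} | (A \subset B) && (#|A| == 2)].

Definition equivalence_graph (T : finType) (K : {set T} * {set {set T}}) :
  bool :=
  [exists P : {set {set T}},
    partition P K.1 && (K.2 == \bigcup_(B in P) clique_edges B)].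

Definition equivalence_covering (H : sgraph)
    (C : {set {set H} * {set {set H}}}) : bool :=
  [forall K in C, subgraph_of K && equivalence_graph K]
  && (\bigcup_(K in C) K.2 == edges H).

Lemma edgesP (G : sgraph) (A : {set G}) :
  reflect (exists x y, adj x y /\ A = [set x; y]) (A \in edges G).
Proof.
apply: (iffP imsetP) => [[[x y]]|[x [y [xy ->]]]].
  by rewrite inE /= => xy ->; exists x, y.
by exists (x, y); rewrite ?inE.
Qed.

Lemma equivalence_covering_ex (H : sgraph) :
  exists k, [exists C : {set {set H} * {set {set H}}},
              equivalence_covering C && (#|C| == k)].
Proof.
pose C := [set (A, [set A]) | A in edges H].
exists #|C|; apply/existsP; exists C; rewrite eqxx andbT.
apply/andP; split; last first.
  apply/eqP/setP=> A; apply/bigcupP/idP => [[K /imsetP[B HB ->]]|HA].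
    by rewrite /= inE => /eqP->.
  by exists (A, [set A]); rewrite ?inE ?eqxx //; apply: imset_f.
apply/forall_inP=> K /imsetP[A HA ->]; apply/andP; split.
  by apply/andP; split=> /=; [rewrite sub1set|apply/forall_inP=> B; rewrite inE => /eqP->].
have cA : #|A| = 2.
  have /edgesP[x [y [xy ->]]] := HA; rewrite cards2; case: eqVneq xy => // ->.
  by rewrite adj_irrefl.
apply/existsP; exists [set A]; apply/andP; split.
  rewrite /partition /cover big_set1 eqxx /= trivIset1 inE /=.
  by apply/eqP=> A0; rewrite -A0 cards0 in cA.
apply/eqP/setP=> B; rewrite big_set1 !inE /=.
apply/eqP/andP => [->|[sBA /eqP cB]]; first by rewrite subxx cA.
by apply/eqP; rewrite eqEcard sBA cA cB.
Qed.

Definition equivalence_number (H : sgraph) : nat :=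
  ex_minn (equivalence_covering_ex H).

Section LineGraph.
Variable G : sgraph.

Definition line_vert : finType := {A : {set G} | A \in edges G}.

Definition line_adj : rel line_vert :=
  fun A B => (A != B) && (val A :&: val B != set0).

Lemma line_adj_sym : symmetric line_adj.
Proof. by move=> A B; rewrite /line_adj eq_sym setIC. Qed.

Lemma line_adj_irrefl : irreflexive line_adj.
Proof. by move=> A; rewrite /line_adj eqxx. Qed.

Definition line_graph : sgraph := SGraph line_adj_sym line_adj_irrefl.

End LineGraph.

(* (u, v) \in D stands for the arc from u to v. *)
Definition orientation (G : sgraph) (D : {set G * G}) : bool :=
  [forall u : G, forall v : G,
    if adj u v then ((u, v) \in D) (+) ((v, u) \in D) else (u, v) \notin D].

Definition orientation_covering (G : sgraph) (C : {set {set G * G}}) : bool :=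
  [forall D in C, orientation D]
  && [forall u : G, forall v : G, forall w : G,
       [&& adj u v, adj u w & v != w] ==>
       [exists D in C, ((u, v) \in D) && ((u, w) \in D)]].

Lemma orientation_covering_ex (G : sgraph) :
  exists k, [exists C : {set {set G * G}},
              orientation_covering C && (#|C| == k)].
Proof.
pose C := [set D : {set G * G} | orientation D].
exists #|C|; apply/existsP; exists C; rewrite eqxx andbT.
apply/andP; split; first by apply/forall_inP=> D; rewrite inE.
apply/forallP=> u; apply/forallP=> v; apply/forallP=> w.
apply/implyP=> /and3P[uv uw _].
pose D := [set p : G * G | adj p.1 p.2 &&
  ((p.1 == u) || (p.2 != u) && (enum_rank p.1 < enum_rank p.2))].
apply/existsP; exists D; rewrite !inE /= uv uw eqxx /= andbT.
apply/forallP=> x; apply/forallP=> y; rewrite !inE /= (adj_sym y x).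
case: (boolP (adj x y)) => //= xy; case: (eqVneq x u) => [xu|xu] /=.
  by case: (eqVneq y u) => //= yu; rewrite xu yu adj_irrefl in xy.
case: (eqVneq y u) => //= yu.
case: ltngtP => // /val_inj /enum_rank_inj exy.
by rewrite exy adj_irrefl in xy.
Qed.

Definition sigma (G : sgraph) : nat := ex_minn (orientation_covering_ex G).

(* Main.v *)
Require Import Defs.
From mathcomp Require Import all_boot.

(** Given an orientation, grouping the edges of [G] by their tails partitions
    the vertices of the line graph into cliques, and two edges sharing [u] fall
    in the same clique as soon as both leave [u]; hence the first inequality.

    Conversely, a clique of the line graph is a star or a triangle, so at most
    three vertices of [G] are shared by two distinct edges of the clique. An
    equivalence subgraph thus yields three orientations: the [j]-th one orients
    the edges of each clique away from its [j]-th shared vertex. *)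

Set Implicit Arguments.
Unset Strict Implicit.
Unset Printing Implicit Defensive.

(** * The two minima as bounds and as attained values *)

Lemma equivalence_number_le (H : sgraph) (C : {set {set H} * {set {set H}}}) :
  equivalence_covering C -> equivalence_number H <= #|C|.
Proof.
move=> covC; rewrite /equivalence_number; case: ex_minnP => k _; apply.
by apply/existsP; exists C; rewrite covC eqxx.
Qed.

Lemma equivalence_number_attained (H : sgraph) :
  exists2 C : {set {set H} * {set {set H}}},
    equivalence_covering C & #|C| = equivalence_number H.
Proof.
rewrite /equivalence_number; case: ex_minnP => k /existsP[C /andP[covC /eqP <-]] _.
by exists C.
Qed.

Lemma sigma_le (G : sgraph) (C : {set {set G * G}}) :
  orientation_covering C -> sigma G <= #|C|.
Proof.
move=> covC; rewrite /sigma; case: ex_minnP => k _; apply.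
by apply/existsP; exists C; rewrite covC eqxx.
Qed.

Lemma sigma_attained (G : sgraph) :
  exists2 C : {set {set G * G}}, orientation_covering C & #|C| = sigma G.
Proof.
rewrite /sigma; case: ex_minnP => k /existsP[C /andP[covC /eqP <-]] _.
by exists C.
Qed.

(** * Edges as two-element sets, and adjacency in the line graph *)

Lemma adj_neq (G : sgraph) (x y : G) : adj x y -> x != y.
Proof. by apply: contraTneq => ->; rewrite adj_irrefl. Qed.

Lemma card_edge (G : sgraph) (A : {set G}) : A \in edges G -> #|A| = 2.
Proof. by case/edgesP=> x [y [/adj_neq xy ->]]; rewrite cards2 xy. Qed.

Lemma edge_of_pair (G : sgraph) (x y : G) :
  ([set x; y] \in edges G) = adj x y.
Proof.
apply/edgesP/idP => [[a [b [ab E]]]|xy]; last by exists x, y.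
have := set21 x y; rewrite E !inE => xab; have := set22 x y; rewrite E !inE => yab.
have xy : x != y by have := cards2 x y; rewrite E cards2 (adj_neq ab); case: (x != y).
case/orP: xab xy => /eqP->; case/orP: yab => /eqP->; rewrite ?eqxx //.
by rewrite adj_sym.
Qed.

Lemma edge_through (G : sgraph) (A : {set G}) (u : G) :
  A \in edges G -> u \in A -> exists2 v, adj u v & A = [set u; v].
Proof.
case/edgesP=> x [y [xy ->]]; rewrite !inE => /orP[]/eqP->; first by exists y.
by exists x; rewrite 1?adj_sym // setUC.
Qed.

Lemma orientation_arc (G : sgraph) (D : {set G * G}) (u v : G) :
  orientation D -> (u, v) \in D -> adj u v && ((v, u) \notin D).
Proof.
move=> /forallP/(_ u)/forallP/(_ v); case: ifP => [_|_ /negP//].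
by move=> + uvD; rewrite uvD addTb.
Qed.

Lemma line_adjP (G : sgraph) (e f : line_graph G) :
  reflect (e != f /\ exists2 u, u \in val e & u \in val f) (adj e f).
Proof.
rewrite /= /line_adj; apply: (iffP andP) => -[ef].
  by case/set0Pn=> u /setIP[ue uf]; split=> //; exists u.
by case=> u ue uf; split=> //; apply/set0Pn; exists u; rewrite inE ue.
Qed.

(** * From an orientation to an equivalence subgraph of the line graph *)

Section TailPartition.
Variables (G : sgraph) (D : {set G * G}).
Hypothesis orD : orientation D.

Definition tail (e : line_graph G) : option G :=
  [pick u | [exists v, (val e == [set u; v]) && ((u, v) \in D)]].

Lemma tail_mem e u : tail e = Some u -> u \in val e.
Proof.
rewrite /tail; case: pickP => // x /existsP[v /andP[/eqP-> _]] [<-].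
exact: set21.
Qed.

Lemma tail_neq_None e : tail e != None.
Proof.
rewrite /tail; case: pickP => // noTail.
have /edgesP[x [y [xy E]]] := valP e.
have /forallP/(_ x)/forallP/(_ y) := orD; rewrite xy.
have:= noTail x; have:= noTail y => /existsP Ny /existsP Nx.
case xyD: ((x, y) \in D); first by case: Nx; exists y; rewrite E eqxx.
by case yxD: ((y, x) \in D) => // _; case: Ny; exists x; rewrite E setUC eqxx.
Qed.

(** If [pick] returned some [x != u], then [x = v] and its head is [u], so [D] would contain both
    arcs of the same edge. *)
Lemma tailE e u v : val e = [set u; v] -> (u, v) \in D -> tail e = Some u.
Proof.
move=> E uvD; have /andP[uv vuD] := orientation_arc orD uvD.
rewrite /tail; case: pickP => [x /existsP[y /andP[/eqP Exy xyD]]|/(_ u)]; last first.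
  by move/existsP; case; exists v; rewrite E eqxx.
congr Some; apply/eqP; move: vuD; apply: contraNT => xu.
have := set21 x y; rewrite -Exy E !inE (negPf xu) /= => /eqP xv; subst x.
have := set21 u v; rewrite -E Exy !inE eq_sym (negPf xu) /= => /eqP uy.
by rewrite uy.
Qed.

Definition tail_partition := preim_partition tail [set: line_graph G].

Definition tail_graph : {set line_graph G} * {set {set line_graph G}} :=
  (setT, \bigcup_(B in tail_partition) clique_edges B).

Lemma tail_graph_edge e f :
  e != f -> tail e = tail f -> [set e; f] \in tail_graph.2.
Proof.
move=> ef tef; apply/bigcupP; exists [set g in setT | tail e == tail g].
  by apply/imsetP; exists e.
rewrite inE cards2 ef andbT; apply/subsetP=> g.
by rewrite !inE => /orP[]/eqP->; rewrite ?tef eqxx.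
Qed.

(** Two edges in one block have the same tail, and that vertex lies in both, so they are adjacent in
    the line graph. *)
Lemma tail_graph_subgraph : subgraph_of tail_graph.
Proof.
apply/andP; split; last by apply/forall_inP=> A _; apply: subsetT.
apply/subsetP=> A /bigcupP[B /imsetP[x _ ->]].
rewrite inE => /andP[sub /cards2P[e [f [ef EA]]]]; subst A.
have /eqP te : tail x == tail e by have := subsetP sub e (set21 e f); rewrite !inE.
have /eqP tf : tail x == tail f by have := subsetP sub f (set22 e f); rewrite !inE.
rewrite edge_of_pair; apply/line_adjP; split=> //.
case tx: (tail x) (tail_neq_None x) => [u|//] _.
by exists u; apply: tail_mem; rewrite -?te -?tf.
Qed.

Lemma tail_graph_equivalence : equivalence_graph tail_graph.
Proof.
by apply/existsP; exists tail_partition; rewrite preim_partitionP eqxx.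
Qed.

End TailPartition.

Lemma equivalence_number_le_sigma (G : sgraph) :
  equivalence_number (line_graph G) <= sigma G.
Proof.
have [C /andP[/forall_inP orC /forallP covC] <-] := sigma_attained G.
(* Distinct orientations may yield the same [tail_graph], so the image can only be smaller than
   [C]. *)
apply: (@leq_trans #|[set tail_graph D | D in C]|); last exact: leq_imset_card.
apply: equivalence_number_le; apply/andP; split.
  apply/forall_inP=> _ /imsetP[D DC ->].
  by rewrite tail_graph_subgraph ?tail_graph_equivalence ?orC.
rewrite eqEsubset; apply/andP; split.
  apply/bigcupsP=> _ /imsetP[D DC ->].
  by have /andP[] := tail_graph_subgraph (orC _ DC).
apply/subsetP=> _ /edgesP[e [f [/line_adjP[ef [u ue uf]] ->]]].
have [v uv Ee] := edge_through (valP e) ue.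
have [w uw Ef] := edge_through (valP f) uf.
have vw : v != w.
  by apply: contraNneq ef => vw; apply/eqP/val_inj; rewrite Ee Ef vw.
have := covC u => /forallP/(_ v)/forallP/(_ w); rewrite uv uw vw /=.
case/exists_inP=> D DC /andP[uvD uwD].
apply/bigcupP; exists (tail_graph D); first exact: imset_f.
apply: tail_graph_edge => //.
by rewrite (tailE (orC _ DC) Ee uvD) (tailE (orC _ DC) Ef uwD).
Qed.

(** * Orienting edges away from assigned vertices *)

Section OrientFrom.
Variables (G : sgraph) (c : {set G} -> option G).

(* Edges not incident to their assigned vertex follow the enumeration order. *)
Definition orient_from : {set G * G} :=
  [set p : G * G | adj p.1 p.2 &&
    let z := c [set p.1; p.2] in
    (Some p.1 == z) || (Some p.2 != z) && (enum_rank p.1 < enum_rank p.2)].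

(** Both directions of an edge consult the same value of [c], since it is applied to the unordered
    pair. That value is at most one of the two ends; if it is neither, the strict order of ranks
    selects exactly one arc. *)
Lemma orient_from_orientation : orientation orient_from.
Proof.
apply/forallP=> x; apply/forallP=> y; rewrite !inE /= (adj_sym y x) (setUC [set y]).
case: (boolP (adj x y)) => //= xy.
case: (eqVneq (Some x) _) => [<-|xz] /=.
  by rewrite orbF; apply: (adj_neq (_ : adj y x)); rewrite adj_sym.
case: (eqVneq (Some y) _) => //= yz.
case: ltngtP => // /val_inj /enum_rank_inj exy.
by rewrite exy adj_irrefl in xy.
Qed.

Lemma orient_from_arc u v :
  adj u v -> c [set u; v] = Some u -> (u, v) \in orient_from.
Proof. by move=> uv cu; rewrite inE /= uv cu eqxx. Qed.

End OrientFrom.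

(** * Shared vertices of a clique of the line graph *)

Section SharedVertices.
Variable G : sgraph.
Implicit Types (B : {set line_graph G}) (e f g : line_graph G).

(** For a clique [B] with at least two edges, this is the centre of a star or the three vertices of
    a triangle. *)
Definition shared B : {set G} :=
  [set u | [exists e in B, exists f in B,
             [&& e != f, u \in val e & u \in val f]]].

Lemma sharedP B u :
  reflect (exists e f, [/\ e \in B, f \in B, e != f, u \in val e & u \in val f])
          (u \in shared B).
Proof.
rewrite inE; apply: (iffP exists_inP) => [[e eB /exists_inP[f fB /and3P[]]]|].
  by exists e, f.
by move=> [e [f [eB fB ef ue uf]]]; exists e => //; apply/exists_inP; exists f; rewrite ?ef ?ue.
Qed.

Lemma edge_eq_of_two_ends e f (u v : G) :
  u != v -> u \in val e -> v \in val e -> u \in val f -> v \in val f -> e = f.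
Proof.
move=> uv ue ve uf vf.
have key g : u \in val g -> v \in val g -> val g = [set u; v].
  move=> ug vg; apply/esym/eqP; rewrite eqEcard cards2 uv (card_edge (valP g)).
  by rewrite leqnn andbT; apply/subsetP=> w; rewrite !inE => /orP[]/eqP->.
exact: val_inj (etrans (key e ue ve) (esym (key f uf vf))).
Qed.

Lemma edge_other_end_unique g (x y z : G) : x \in val g -> y \in val g -> z \in val g ->
  x != y -> x != z -> y = z.
Proof.
move=> xg yg zg xy xz; have [v _ E] := edge_through (valP g) xg.
move: yg zg; rewrite E !inE ![_ == x]eq_sym (negPf xy) (negPf xz) /=.
by move=> /eqP-> /eqP->.
Qed.

(** The star and triangle cases need not be separated: all shared vertices lie in the union of two
    distinct edges [e] and [f] meeting at [u], which has at most three vertices. *)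
Lemma card_shared_le3 B :
  {in B &, forall e f, e != f -> adj e f} -> #|shared B| <= 3.
Proof.
move=> cliqueB; have [->|[u /sharedP[e [f [eB fB ef ue uf]]]]] := set_0Vmem (shared B).
  by rewrite cards0.
have card3 : #|val e :|: val f| <= 3.
  rewrite cardsU !(card_edge (valP _)) leq_subLR addnC -ltnS ltn_add2l.
  by apply/card_gt0P; exists u; rewrite inE ue.
apply: leq_trans card3; apply/subset_leq_card/subsetP=> v.
(* If [v] lay outside both [e] and [f], then [g] and [h] would each contain [u] and [v], hence
   coincide. *)
case/sharedP=> g [h [gB hB gh vg vh]]; apply: contraNT gh.
rewrite inE negb_or => /andP[ve vf].
have vu : v != u by apply: contraNneq ve => ->.
(* An edge of [B] through [v] meets [e] and [f] outside [v], hence at [u]. *)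
have key k : k \in B -> v \in val k -> u \in val k.
  move=> kB vk.
  have ke : k != e by apply: contraNneq ve => <-.
  have kf : k != f by apply: contraNneq vf => <-.
  have [_ [x xk xe]] := line_adjP _ _ (cliqueB _ _ kB eB ke).
  have [_ [y yk yf]] := line_adjP _ _ (cliqueB _ _ kB fB kf).
  have vx : v != x by apply: contraNneq ve => ->.
  have vy : v != y by apply: contraNneq vf => ->.
  (* Besides [v], the edge [k] has a single end, which therefore lies in both [e] and [f]. *)
  have xy := edge_other_end_unique vk xk yk vx vy; subst y.
  case: (eqVneq x u) xk => [-> //|xu _].
  by case/eqP: ef; apply: (edge_eq_of_two_ends xu).
by apply/eqP/(edge_eq_of_two_ends vu); rewrite ?key.
Qed.

End SharedVertices.

(** * From an equivalence subgraph to three orientations *)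

Section ThreeOrientations.
Variables (G : sgraph).
Implicit Types (K : {set line_graph G} * {set {set line_graph G}}).

(** Reads the clique of [e] off the edge set, because the partition is only known to exist. The case
    [f == e] is separate since cliques have no loops. *)
Definition block K (e : line_graph G) : {set line_graph G} :=
  [set f | (f == e) || ([set e; f] \in K.2)].

(** An edge of [K.2] at [e] comes from a block containing [e], and by disjointness of blocks that
    block is [B]. *)
Lemma blockE K (P : {set {set line_graph G}}) (B : {set line_graph G}) e :
  partition P K.1 -> K.2 = \bigcup_(B in P) clique_edges B ->
  B \in P -> e \in B -> block K e = B.
Proof.
move=> partP EK BP eB; apply/setP=> f; rewrite inE EK.
have [->|fe] := eqVneq f e; first by rewrite eB.
apply/bigcupP/idP => [[B' B'P]|fB].
  rewrite inE => /andP[/subsetP sub _].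
  suff <- : B' = B by apply: sub; rewrite set22.
  have trivP := partition_trivIset partP.
  by rewrite -(def_pblock trivP BP eB) (def_pblock trivP B'P) ?sub ?set21.
exists B => //; rewrite inE cards2 [e == f]eq_sym fe andbT.
by apply/subsetP=> g; rewrite !inE => /orP[]/eqP->.
Qed.

(** When the clique has at most [j] shared vertices, [onth] gives [None], and [orient_from] falls
    back on the enumeration order. *)
Definition center K (j : nat) (A : {set G}) : option G :=
  obind (fun e => onth (enum (shared (block K e))) j)
        (insub A : option (line_vert G)).

(** Both edges lie in one block and so read the same list of shared vertices; [j] is the position of
    [u] in it, below 3 by [card_shared_le3]. *)
Lemma center_shared K (e f : line_graph G) u :
  subgraph_of K -> equivalence_graph K ->
  [set e; f] \in K.2 -> e != f -> u \in val e -> u \in val f ->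
  exists j : 'I_3, center K j (val e) = Some u /\ center K j (val f) = Some u.
Proof.
move=> /andP[/subsetP sK _] /existsP[P /andP[partP /eqP EK]] efK ef ue uf.
move: (efK); rewrite {1}EK => /bigcupP[B BP].
rewrite inE => /andP[/subsetP sub _].
have eB : e \in B by rewrite sub ?set21.
have fB : f \in B by rewrite sub ?set22.
(* All pairs in a block are edges of [K], and [K] is a subgraph of the line graph. *)
have clB : {in B &, forall g h, g != h -> adj g h}.
  move=> g h gB hB gh; rewrite -edge_of_pair; apply: sK; rewrite EK.
  apply/bigcupP; exists B => //; rewrite inE cards2 gh andbT.
  by apply/subsetP=> k; rewrite !inE => /orP[]/eqP->.
have uS : u \in enum (shared B) by rewrite mem_enum; apply/sharedP; exists e, f.
have ltj : index u (enum (shared B)) < 3.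
  by apply: leq_trans (card_shared_le3 clB); rewrite cardE index_mem.
exists (Ordinal ltj); rewrite /center !valK /= !(blockE partP EK BP) //.
by rewrite onthE (nth_map u) ?index_mem // nth_index.
Qed.

Lemma sigma_le_3_equivalence_number :
  sigma G <= 3 * equivalence_number (line_graph G).
Proof.
have [C /andP[/forall_inP eqC /eqP covC] <-] :=
  equivalence_number_attained (line_graph G).
pose F (p : ({set line_graph G} * {set {set line_graph G}}) * 'I_3) :=
  orient_from (center p.1 p.2).
apply: (@leq_trans #|F @: setX C [set: 'I_3]|); last first.
  by apply: leq_trans (leq_imset_card _ _) _; rewrite cardsX cardsT card_ord mulnC.
apply: sigma_le; apply/andP; split.
  by apply/forall_inP=> _ /imsetP[p _ ->]; apply: orient_from_orientation.
apply/forallP=> u; apply/forallP=> v; apply/forallP=> w.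
apply/implyP=> /and3P[uv uw vw].
have uvE : [set u; v] \in edges G by rewrite edge_of_pair.
have uwE : [set u; w] \in edges G by rewrite edge_of_pair.
pose e : line_graph G := Sub [set u; v] uvE.
pose f : line_graph G := Sub [set u; w] uwE.
have ef : e != f.
  apply: contraNneq vw => /(congr1 val)/= /setP/(_ v).
  by rewrite !inE eqxx orbT eq_sym (negPf (adj_neq uv)) => /esym.
have : [set e; f] \in edges (line_graph G).
  rewrite edge_of_pair; apply/line_adjP; split=> //.
  by exists u; rewrite /= set21.
rewrite -covC => /bigcupP[K KC efK].
have /andP[subK eqK] := eqC K KC.
have [j [ce cf]] := center_shared subK eqK efK ef (set21 u v) (set21 u w).
(* [K] covers the pair of edges [e] and [f], and its orientation number [j] directs both away from
   [u]. *)
apply/exists_inP; exists (F (K, j)); first by apply: imset_f; rewrite !inE KC.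
by rewrite !orient_from_arc.
Qed.

End ThreeOrientations.

Theorem theorem4 (G : sgraph) :
  equivalence_number (line_graph G) <= sigma G
    <= 3 * equivalence_number (line_graph G).
Proof. by rewrite equivalence_number_le_sigma sigma_le_3_equivalence_number. Qed.
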